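(* Let $G=(V,E)$ be a finite DAG, let $\mathcal{H}_G\subseteq\mathbb{R}^E$ be the set of non-generic weight matrices supported on $G$, and let $C\in\mathbb{R}^E\setminus\mathcal{H}_G$ be generic. The set $$\operatorname{cone}_G(C):=\{C'\in\mathbb{R}^E\setminus\mathcal{H}_G:\mathcal{M}_*(G,C)=\mathcal{M}_*(G,C')\}$$ is a full-dimensional open polyhedral cone, defined by the linear inequalities (in $C'\in\mathbb{R}^E$) $$\omega_{C'}\big(\pi^{ij}_{\mathrm{crit}}(G,C)\big)>\omega_{C'}(\pi)\quad\text{for each }\pi\in P(i,j)\setminus\{\pi^{ij}_{\mathrm{crit}}(G,C)\},$$ for all distinct $i,j\in V$ (with $P(i,j)\neq\emptyset$).
   Context: Let $G=(V,E)$ be a finite DAG. $\mathbb{R}^E$ denotes the set of weight matrices supported on $G$: $V\times V$ matrices $C=(c_{ij})$ with $c_{ij}\in\mathbb{R}$ if $i\to j\in E$ and $c_{ij}=-\infty$ otherwise (identified with the Euclidean space indexed by $E$). For distinct $i,j\in V$, $P(i,j)$ is the set of directed paths from $i$ to $j$ in $G$, and the weight of a path $\pi$ is $\omega_C(\pi)=\sum_{e\in\pi}c_e$. A path in $P(i,j)$ is critical (for $(G,C)$) if its weight is maximal among all paths in $P(i,j)$. $C$ is generic if for all distinct $i,j$ with $P(i,j)\ne\emptyset$ there is exactly one critical path from $i$ to $j$; it is then denoted $\pi^{ij}_{\mathrm{crit}}(G,C)$. For $L\subseteq V$, the critical DAG $G^*_{C,L}$ is the DAG on $V$ with an edge $i\to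 j$ ($i\neq j$) if and only if $P(i,j)\neq\emptyset$ and no critical path from $i$ to $j$ in $(G,C)$ has an interior node in $L$. Distinct $i,j\in V\setminus L$ are $C^*$-connected given $L$ if $G^*_{C,L}$ contains, up to exchanging $i$ and $j$, a path of one of the forms (a) $i\to j$; (b) $i\leftarrow p\to j$; (c) $i\to \ell\leftarrow j$; (d) $i\leftarrow p\to\ell\leftarrow j$; (e) $i\leftarrow p\to\ell\leftarrow q\to j$, with $\ell\in L$ and $p,q\notin L$. Otherwise they are $C^*$-separated given $L$. For pairwise disjoint $I,J,L\subseteq V$, $I$ and $J$ are $C^*$-separated given $L$ if every $i\in I$ and $j\in J$ are $C^*$-separated given $L$. The maxoid $\mathcal{M}_*(G,C)$ is the set of all triples (CI statements) $[I\perp\!\!\!\perp J\mid L]$ with $I,J,L$ pairwise disjoint such that $I$ and $J$ are $C^*$-separated given $L$ in $(G,C)$. An open polyhedral cone is a finite intersection of open linear half-spaces (possibly the whole space). *)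

(* Defs.v *)
From mathcomp Require Import all_boot all_order all_algebra.
From mathcomp Require Import boolp classical_sets cardinality reals.

Set Implicit Arguments.
Unset Strict Implicit.
Unset Printing Implicit Defensive.

Import Order.TTheory GRing.Theory Num.Theory.

Local Open Scope classical_set_scope.
Local Open Scope ring_scope.

(* [cycle E c] holds trivially for [c = [::]]; self-loops are excluded by
   [c = [:: x]]. *)
Definition acyclic (V : finType) (E : rel V) : Prop :=
  forall c : seq V, cycle E c -> c = [::].

Definition edge (V : finType) (E : rel V) := {e : V * V | E e.1 e.2}.

Definition src (V : finType) (E : rel V) (e : edge E) : V := (val e).1.
Definition tgt (V : finType) (E : rel V) (e : edge E) : V := (val e).2.

(* P(i,j): a path is the nonempty list of its edges. In an acyclic graph its
   nodes are automatically distinct. *)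
Definition dipath (V : finType) (E : rel V) (i j : V) : set (seq (edge E)) :=
  [set p | if p is e :: q then
             [/\ src e = i,
                 path (fun e1 e2 : edge E => tgt e1 == src e2) e q &
                 tgt (last e q) = j]
           else False].

Definition interior_nodes (V : finType) (E : rel V) (p : seq (edge E)) :
  seq V := [seq src e | e <- behead p].

(* R^E: only the entries c_ij with i -> j in E are recorded; the others are
   -oo and never occur in the weight of a path. *)
Definition weights (R : realType) (V : finType) (E : rel V) :=
  {ffun edge E -> R}.

Definition pweight (R : realType) (V : finType) (E : rel V)
    (C : weights R E) (p : seq (edge E)) : R :=
  \sum_(e <- p) C e.

Definition critical (R : realType) (V : finType) (E : rel V)
    (C : weights R E) (i j : V) : set (seq (edge E)) :=
  [set p | dipath i j p /\
           forall q : seq (edge E), dipath i j q ->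
             pweight C q <= pweight C p].

Definition generic (R : realType) (V : finType) (E : rel V)
    (C : weights R E) : Prop :=
  forall i j : V, i != j -> dipath (E := E) i j !=set0 ->
    exists! p : seq (edge E), critical C i j p.

Definition nongeneric (R : realType) (V : finType) (E : rel V) :
  set (weights R E) := [set C : weights R E | ~ generic C].

(* The default value [::] is irrelevant: a critical path exists as soon as
   there is a path from i to j in a finite acyclic graph. *)
Definition crit_path (R : realType) (V : finType) (E : rel V)
    (C : weights R E) (i j : V) : seq (edge E) :=
  xget [::] (critical C i j).

Definition crit_dag (R : realType) (V : finType) (E : rel V)
    (C : weights R E) (L : {set V}) (i j : V) : Prop :=
  [/\ i != j, dipath (E := E) i j !=set0 &
      forall p : seq (edge E), critical C i j p ->
        forall v : V, v \in interior_nodes p -> v \notin L].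

(* The repetition of nodes need not be excluded: an instance of [StarD] or
   [StarE] with a repeated node contains an edge between i and j or an
   instance of [StarB]. *)
Inductive star_path (R : realType) (V : finType) (E : rel V)
    (C : weights R E) (L : {set V}) (i j : V) : Prop :=
| StarA of crit_dag C L i j
| StarB (p : V) of p \notin L & crit_dag C L p i & crit_dag C L p j
| StarC (l : V) of l \in L & crit_dag C L i l & crit_dag C L j l
| StarD (p l : V) of p \notin L & l \in L &
    crit_dag C L p i & crit_dag C L p l & crit_dag C L j l
| StarE (p l q : V) of p \notin L & l \in L & q \notin L &
    crit_dag C L p i & crit_dag C L p l &
    crit_dag C L q l & crit_dag C L q j.

Definition star_connected (R : realType) (V : finType) (E : rel V)
    (C : weights R E) (L : {set V}) (i j : V) : Prop :=
  star_path C L i j \/ star_path C L j i.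

Definition star_separated (R : realType) (V : finType) (E : rel V)
    (C : weights R E) (I J L : {set V}) : Prop :=
  forall i j : V, i \in I -> j \in J -> ~ star_connected C L i j.

(* The triple (A, B, L) stands for the CI statement [A _||_ B | L].
   The notation [disjoint _ & _] of fintype is shadowed by classical_sets. *)
Definition maxoid (R : realType) (V : finType) (E : rel V)
    (C : weights R E) : set ({set V} * {set V} * {set V}) :=
  [set s : {set V} * {set V} * {set V} | let: (A, B, L) := s in
     [/\ fintype.disjoint (mem A) (mem B),
         fintype.disjoint (mem A) (mem L),
         fintype.disjoint (mem B) (mem L) &
         star_separated C A B L]].

Definition maxoid_cone (R : realType) (V : finType) (E : rel V)
    (C : weights R E) : set (weights R E) :=
  [set C' : weights R E | ~ nongeneric C' /\ maxoid C = maxoid C'].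

Definition open_halfspace (R : realType) (T : finType) (a : {ffun T -> R}) :
  set {ffun T -> R} := [set x : {ffun T -> R} | 0 < \sum_t a t * x t].

(* The zero functional is excluded since it does not define a half-space. *)
Definition open_polyhedral_cone (R : realType) (T : finType)
    (S : set {ffun T -> R}) : Prop :=
  exists A : set {ffun T -> R},
    [/\ finite_set A, ~ A 0 & S = \bigcap_(a in A) open_halfspace a].

Definition affine_hull (R : realType) (T : finType)
    (S : set {ffun T -> R}) : set {ffun T -> R} :=
  [set y : {ffun T -> R} |
     exists (n : nat) (x : 'I_n -> {ffun T -> R}) (w : 'I_n -> R),
     [/\ forall k, S (x k), \sum_k w k = 1 &
         forall t, y t = \sum_k w k * x k t]].

Definition full_dimensional (R : realType) (T : finType)
    (S : set {ffun T -> R}) : Prop :=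
  affine_hull S = setT.

(* Main.v *)
Require Import Defs.
From mathcomp Require Import all_boot all_order all_algebra.
From mathcomp Require Import boolp classical_sets cardinality reals.
From mathcomp Require Import ring lra.

(** The maxoid determines the critical paths: suppose the [C]-critical and
    [C']-critical paths from [i] to [j] leave [i] through distinct nodes [k] and
    [k']. One of these is not an ancestor of the other, say [k] is not an
    ancestor of [k']. Condition on the set [L] of all nodes other than [i] from
    which [k'] is reachable. The [C]-critical path avoids [L], while the
    [C']-critical path meets it in [k']; and no longer connecting path is
    possible for [C'], because every ancestor of [i], and every ancestor of a
    node of [L] other than [i], lies in [L]. So the two maxoids differ.
    Induction along the paths then identifies them edge by edge. *)

Set Implicit Arguments.
Unset Strict Implicit.
Unset Printing Implicit Defensive.

Import Order.TTheory GRing.Theory Num.Theory.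

Local Open Scope classical_set_scope.
Local Open Scope ring_scope.

(** * Full-dimensionality of nonempty open polyhedral cones *)

Section OpenCone.
Variables (R : realType) (T : finType).
Implicit Types (S : set {ffun T -> R}) (a x z : {ffun T -> R}).

(** Finitely many strict inequalities leave a common positive slack at [x], hence a uniform step
    size in the direction [z]. *)
Lemma halfspaces_perturb (s : seq {ffun T -> R}) x z :
    (forall a, a \in s -> open_halfspace a x) ->
  exists2 eps : R, 0 < eps & forall (a : {ffun T -> R}) (u : R), a \in s ->
    0 <= u -> u <= eps -> 0 < (\sum_t a t * x t) + u * (\sum_t a t * z t).
Proof.
elim: s => [|a s IHs] hs; first by exists 1.
have [|eps eps0 heps] := IHs; first by move=> b bs; apply: hs; rewrite inE bs orbT.
have ax : 0 < \sum_t a t * x t by apply: (hs a); rewrite mem_head.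
set ax' := \sum_t a t * x t in ax *; set az := \sum_t a t * z t.
have az1 : 0 < 1 + `|az| by rewrite ltr_pwDl.
(* The summand 1 keeps the denominator positive and makes the bound strict:
   [u * |az| <= ax' - u < ax'] for [u > 0]. *)
exists (Num.min eps (ax' / (1 + `|az|))).
  by rewrite lt_min eps0 divr_gt0.
move=> b u; rewrite inE le_min => /orP[/eqP ->|bs] u0 /andP[u1 u2]; last exact: heps.
rewrite -/ax' -/az.
have u3 : u * (1 + `|az|) <= ax' by rewrite -ler_pdivlMr.
have u4 : - (u * `|az|) <= u * az.
  by rewrite -mulrN ler_wpM2l // lerNl -normrN ler_norm.
have [->|un0] := eqVneq u 0; first by rewrite mul0r addr0.
have : 0 < u by rewrite lt_def un0.
by nra.
Qed.

(* Any [y] lies on the line through [x] and [x + eps * (y - x)], and both points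
   belong to the cone for small [eps]. *)
Lemma open_polyhedral_cone_full_dimensional S :
  open_polyhedral_cone S -> S !=set0 -> full_dimensional S.
Proof.
move=> [A [Afin _ ->]] [x Sx]; apply/seteqP; split=> // y _.
have /finite_seqP[s As] := Afin.
have [|eps eps0 heps] := @halfspaces_perturb s x (y - x).
  by move=> a sa; apply: Sx; rewrite As.
pose x' : {ffun T -> R} := [ffun t => x t + eps * (y t - x t)].
exists 2%N, (fun k : 'I_2 => if k == ord0 then x else x').
(* These weights solve [x' = x + eps * (y - x)] for [y]; the first may be negative, as affine
   combinations allow. *)
exists (fun k : 'I_2 => if k == ord0 then 1 - eps^-1 else eps^-1).
split.
- move=> k; case: ifP => // _ a Aa.
  have as_ : a \in s by move: Aa; rewrite As.
  have := heps a eps as_ (ltW eps0) (lexx _).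
  rewrite mulr_sumr -big_split /=; congr (0 < _); apply: eq_bigr => t _.
  by rewrite !ffunE /=; ring.
- by rewrite !big_ord_recl big_ord0 /=; ring.
- move=> t; rewrite !big_ord_recl big_ord0 /= !ffunE; field.
  by rewrite gt_eqF.
Qed.

End OpenCone.

(** * Reachability and directed paths in an acyclic graph *)

Section DAG.
Variables (V : finType) (E : rel V).
Hypothesis acyE : acyclic E.
Implicit Types (i j k v : V) (e : edge E) (p q : seq (edge E)).

Lemma acyclic_path_last i (s : seq V) : path E i s -> last i s = i -> s = [::].
Proof.
case/lastP: s => // s v; rewrite last_rcons => + vi; rewrite vi => h.
by have := acyE (c := i :: s) h.
Qed.

Lemma acyclic_connect_anti i j : connect E i j -> connect E j i -> i = j.
Proof.
move=> /connectP[s si ->] /connectP[s' si' e].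
have : s ++ s' = [::].
  by apply: (@acyclic_path_last i); rewrite ?cat_path ?si // last_cat -e.
by case: s {si si' e}.
Qed.

Lemma edge_rel e : E (src e) (tgt e).
Proof. exact: (valP e). Qed.

Lemma edge_inj e e' : src e = src e' -> tgt e = tgt e' -> e = e'.
Proof.
by rewrite /src /tgt => h1 h2; apply: val_inj; case: (val e) (val e') h1 h2
  => [a b] [c d] /= -> ->.
Qed.

Definition chain (e1 e2 : edge E) := tgt e1 == src e2.

Lemma chain_path_tgt e q : path chain e q -> path E (tgt e) [seq tgt f | f <- q].
Proof.
elim: q e => //= f q IHq e /andP[/eqP ef fq].
by rewrite ef edge_rel IHq.
Qed.

Lemma dipath_cons i j e q :
  dipath i j (e :: q) <->
  src e = i /\ (if q is [::] then tgt e = j else dipath (tgt e) j q).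
Proof.
case: q => [|f q]; split=> /=.
- by case.
- by case.
- by case=> ei /andP[/eqP ef fq] lj.
- by case=> ei [fe fq lj]; split; rewrite // fe eqxx.
Qed.

Lemma dipath_nodes i j p :
  dipath i j p -> path E i [seq tgt e | e <- p] /\ last i [seq tgt e | e <- p] = j.
Proof.
case: p => [[]|e q [<- eq lj]] /=.
by rewrite edge_rel chain_path_tgt //= last_map.
Qed.

Lemma dipath_connect i j p : dipath i j p -> connect E i j.
Proof.
by move=> /dipath_nodes[h1 h2]; apply/connectP; exists [seq tgt e | e <- p].
Qed.

Lemma dipath_neq i j p : dipath i j p -> i != j.
Proof.
move=> ijp; apply/eqP => eij; move: (ijp) => /dipath_nodes[h1 h2].
have := acyclic_path_last h1; rewrite h2 => /(_ (esym eij)).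
by case: p ijp {h1 h2}.
Qed.

Lemma dipath_src_connect i j p e : dipath i j p -> e \in p -> connect E i (src e).
Proof.
elim: p i => // f p IHp i /dipath_cons[<- hp]; rewrite inE => /orP[/eqP->//|ep].
case: p IHp hp ep => // g p IHp hp ep.
exact: connect_trans (connect1 (edge_rel f)) (IHp _ hp ep).
Qed.

(** If an edge recurred, its target would reach its source; by antisymmetry it would be a loop. *)
Lemma dipath_uniq i j p : dipath i j p -> uniq p.
Proof.
elim: p i => // e p IHp i /dipath_cons[_].
case: p IHp => // f p IHp hp; rewrite cons_uniq (IHp _ hp) andbT.
apply/negP => /(dipath_src_connect hp) hte.
have /acyclic_connect_anti/(_ hte) ste := connect1 (edge_rel e).
by have := acyE (c := [:: src e]); rewrite /= andbT {2}ste edge_rel => /(_ isT).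
Qed.

(** * Critical paths and their recovery from the maxoid *)

Section Weights.
Variable R : realType.
Implicit Types C : weights R E.

Lemma pweight_uniq C p : uniq p -> pweight C p = \sum_e (e \in p)%:R * C e.
Proof.
move=> up; rewrite /pweight big_uniq //= big_mkcond; apply: eq_bigr => e _.
by case: (e \in p); rewrite ?mul1r ?mul0r.
Qed.

(** A heavier path from [tgt e] to [j], prefixed with [e], would beat the whole path. *)
Lemma critical_behead C i j e f q :
  critical C i j [:: e, f & q] -> critical C (tgt e) j (f :: q).
Proof.
move=> [/dipath_cons[ei fq] emax]; split=> // p tp.
have : dipath i j (e :: p) by apply/dipath_cons; split=> //; case: p tp.
by move=> /emax; rewrite /pweight big_cons [leRHS]big_cons lerD2l.
Qed.

Lemma critical_uniq C i j p q :
  generic C -> critical C i j p -> critical C i j q -> p = q.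
Proof.
move=> gC pC qC; have [] := gC i j (dipath_neq pC.1); first by exists p; case: pC.
by move=> r [_ ru]; rewrite -(ru _ pC) -(ru _ qC).
Qed.

Lemma crit_dag_connect C L i j : crit_dag C L i j -> connect E i j.
Proof. by case=> _ [p ijp] _; exact: dipath_connect ijp. Qed.

(** The one-sided half of the separation argument: applied in both directions, it makes the two
    first steps reach each other, hence coincide. *)
Lemma maxoid_sub_connect C C' i j e e' q q' :
    generic C -> maxoid C' `<=` maxoid C ->
    critical C i j (e :: q) -> critical C' i j (e' :: q') ->
    tgt e != tgt e' ->
  connect E (tgt e) (tgt e').
Proof.
move=> gC sM cC cC' nee'; apply/negPn/negP => nconn.
set k := tgt e in nee' nconn; set k' := tgt e' in nee' nconn.
have ij := dipath_neq cC.1.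
have ijc := dipath_connect cC.1.
have /dipath_cons[ei hq] := cC.1; have /dipath_cons[ei' hq'] := cC'.1.
have kj : connect E k j.
  by case: (q) hq => [kj|f r /dipath_connect //]; rewrite /k kj.
(* Since [k] reaches [j] but not [k'], the node [k'] differs from [j] and is interior to the
   [C']-critical path. *)
have [k'j k'q'] : connect E k' j /\
    exists2 v, v \in interior_nodes (e' :: q') & v = k'.
  case: (q') hq' => [k'j|f r h]; first by rewrite /k' k'j kj in nconn.
  split; first exact: dipath_connect h.
  by exists (src f); [rewrite mem_head|have /dipath_cons[]:= h].
have nk'j : k' <> j by move=> k'E; rewrite k'E kj in nconn.
have ik' : connect E i k' by rewrite -ei'; exact: connect1 (edge_rel e').
have nik' : k' != i.
  apply/eqP => k'i; have := acyE (c := [:: i]).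
  by rewrite /= andbT -{1}ei' -k'i edge_rel => /(_ isT).
pose L := finset (fun v => connect E v k' && (v != i)).
have LP v : v \in L = connect E v k' && (v != i) by rewrite finset.inE.
have no_to_i v : v \notin L -> crit_dag C' L v i -> False.
  move=> vL cvi; have [vi _ _] := cvi; move: vL.
  by rewrite LP vi andbT (connect_trans (crit_dag_connect cvi) ik').
have no_from_j l : l \in L -> crit_dag C' L j l -> False.
  rewrite LP => /andP[lk' _] /crit_dag_connect jl; apply: nk'j.
  exact: acyclic_connect_anti k'j (connect_trans jl lk').
have only_i v l : v \notin L -> l \in L -> crit_dag C' L v l -> v = i.
  rewrite !LP => + /andP[lk' _] /crit_dag_connect vl.
  by rewrite (connect_trans vl lk') /= negbK => /eqP.
have nij : ~ crit_dag C' L i j.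
  move=> [_ _ /(_ _ cC')]; case: k'q' => v vq' vk' /(_ v vq').
  by rewrite LP vk' connect0 nik'.
have [] : maxoid C (finset.set1 i, finset.set1 j, L).
  apply: sM; split.
  - by rewrite finset.disjoints1 finset.inE.
  - by rewrite finset.disjoints1 LP eqxx andbF.
  - rewrite finset.disjoints1 LP; apply/negP => /andP[jk' _].
    exact: nk'j (acyclic_connect_anti k'j jk').
  - move=> a b /finset.set1P -> /finset.set1P -> [|] [].
    + exact: nij.
    + by move=> p pL /(no_to_i _ pL).
    + by move=> l lL _ /(no_from_j _ lL).
    + by move=> p l pL _ /(no_to_i _ pL).
    + by move=> p l q0 pL _ _ /(no_to_i _ pL).
    + by move=> /crit_dag_connect /(acyclic_connect_anti ijc)/eqP; apply/negP.
    + by move=> p pL _ /(no_to_i _ pL).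
    + by move=> l lL /(no_from_j _ lL).
    (* The node [p] outside [L] with an edge into [L] can only be [i], so this path contains the
       excluded edge from [i] to [j]. *)
    + by move=> p l pL lL pj /(only_i _ _ pL lL) pi _; apply: nij; rewrite -pi.
    + by move=> p l q0 _ _ qL _ _ _ /(no_to_i _ qL).
(* For [C] the edge from [i] to [j] is present: interior nodes of the critical path are reachable
   from [k], and one in [L] would connect [k] to [k']. *)
move=> _ _ _ /(_ i j); rewrite !finset.set11 => /(_ isT isT); apply; left.
apply: StarA; split=> //; first by exists (e :: q); case: cC.
move=> p /(critical_uniq gC cC) <- v; rewrite LP => /mapP[f fq ->].
apply/negP => /andP[fk' _]; move/negP: nconn; apply.
case: (q) hq fq => // g r h /(dipath_src_connect h) kf.
exact: connect_trans kf fk'.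
Qed.

Lemma maxoid_critical_eq C C' i j p p' :
    generic C -> generic C' -> maxoid C = maxoid C' ->
    critical C i j p -> critical C' i j p' ->
  p = p'.
Proof.
move=> gC gC' CC'; elim: p p' i => [|e q IHq] [|e' q'] i cC cC' //.
- by case: cC.
- by case: cC'.
have [/dipath_cons[ei hq] /dipath_cons[ei' hq']] := (cC.1, cC'.1).
have tee' : tgt e = tgt e'.
  apply: contrapT => /eqP nee'; have /eqP := nee'; apply.
  apply: acyclic_connect_anti.
    by apply: (maxoid_sub_connect gC _ cC cC' nee'); rewrite CC'.
  by apply: (maxoid_sub_connect gC' _ cC' cC); rewrite ?CC' // eq_sym.
have ee' : e = e' by apply: edge_inj; rewrite // ei ei'.
rewrite ee'; congr (_ :: _).
(* If only one of the paths ended here, the rest of the other would be a path from [j] to itself. *)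
case: q q' {ei ei'} IHq hq hq' cC cC' => [|f q] [|f' q'] // IHq hq hq' cC cC'.
- by have := dipath_neq hq'; rewrite -tee' hq eqxx.
- by have := dipath_neq hq; rewrite tee' hq' eqxx.
- apply: (IHq _ (tgt e)); first exact: critical_behead cC.
  by rewrite tee'; exact: critical_behead cC'.
Qed.

Lemma crit_pathP C i j :
  generic C -> i != j -> dipath (E := E) i j !=set0 ->
  critical C i j (crit_path C i j).
Proof.
move=> gC ij hij; have [p [pC _]] := gC i j ij hij.
exact: xgetPex (ex_intro _ _ pC).
Qed.

(** * The cone cut out by the inequalities *)

Definition crit_ineqs C : set (weights R E) :=
  [set C' : weights R E |
     forall i j : V, i != j -> dipath (E := E) i j !=set0 ->
     forall p : seq (edge E), (dipath i j `\ crit_path C i j) p ->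
     pweight C' (crit_path C i j) > pweight C' p].

(** A tie would produce a second critical path. This makes the cone nonempty. *)
Lemma generic_crit_ineqs C : generic C -> crit_ineqs C C.
Proof.
move=> gC i j ij hij p [ijp /= pn].
have cC := crit_pathP gC ij hij; rewrite lt_neqAle (cC.2 _ ijp) andbT.
apply/eqP => wE; apply: pn; apply: (critical_uniq gC _ cC); split=> // q.
by rewrite wE; exact: cC.2.
Qed.

Lemma crit_ineqs_critical C C' i j p :
  generic C -> crit_ineqs C C' -> i != j -> dipath (E := E) i j !=set0 ->
  critical C' i j p <-> p = crit_path C i j.
Proof.
move=> gC hC' ij hij; have cC := crit_pathP gC ij hij.
split=> [[ijp pmax]|->]; last first.
  split=> [|q ijq]; first exact: cC.1.
  have [->//|/eqP qn] := eqVneq q (crit_path C i j).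
  by apply: ltW; exact: hC'.
apply: contrapT => pn.
by have := pmax _ cC.1; rewrite leNgt hC'.
Qed.

Lemma crit_ineqs_generic C C' : generic C -> crit_ineqs C C' -> generic C'.
Proof.
move=> gC hC' i j ij hij; exists (crit_path C i j).
have h p := crit_ineqs_critical p gC hC' ij hij.
by split; [exact/h|move=> p /h].
Qed.

(** The critical DAG sees the weights only through the critical paths, on which [C] and [C']
    agree. *)
Lemma crit_ineqs_crit_dag C C' :
  generic C -> crit_ineqs C C' -> crit_dag C = crit_dag C'.
Proof.
move=> gC hC'; apply/funext => L; apply/funext => i; apply/funext => j.
apply/propext; split=> -[ij hij hp]; split=> // p pc; apply: hp.
  apply/(crit_ineqs_critical p gC (generic_crit_ineqs gC) ij hij).
  exact/(crit_ineqs_critical p gC hC' ij hij).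
apply/(crit_ineqs_critical p gC hC' ij hij).
exact/(crit_ineqs_critical p gC (generic_crit_ineqs gC) ij hij).
Qed.

Lemma star_path_crit_dag C C' L i j :
  crit_dag C = crit_dag C' -> star_path C L i j -> star_path C' L i j.
Proof.
move=> CC' []; rewrite CC'.
- exact: StarA.
- by move=> p; exact: StarB.
- by move=> l; exact: StarC.
- by move=> p l; exact: StarD.
- by move=> p l q; exact: StarE.
Qed.

Lemma maxoid_crit_dag_sub C C' : crit_dag C = crit_dag C' -> maxoid C `<=` maxoid C'.
Proof.
move=> CC' [[A B] L] [dAB dAL dBL sC]; split=> // i j iA jB cij.
by apply: (sC i j iA jB); case: cij => h; [left|right];
  exact: star_path_crit_dag (esym CC') h.
Qed.

Lemma maxoid_crit_dag C C' : crit_dag C = crit_dag C' -> maxoid C = maxoid C'.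
Proof. by move=> CC'; apply/seteqP; split; exact: maxoid_crit_dag_sub. Qed.

Lemma maxoid_cone_crit_ineqs C : generic C -> maxoid_cone C = crit_ineqs C.
Proof.
move=> gC; apply/seteqP; split=> C' /=.
  move=> [/contrapT gC' CC'] i j ij hij p [ijp /= pn].
  have cC := crit_pathP gC ij hij; have cC' := crit_pathP gC' ij hij.
  have e := maxoid_critical_eq gC gC' CC' cC cC'.
  by rewrite e; apply: (generic_crit_ineqs gC' ij hij); split=> //=; rewrite -e.
move=> hC'; split; last exact/maxoid_crit_dag/crit_ineqs_crit_dag.
by apply; exact: crit_ineqs_generic hC'.
Qed.

Lemma crit_ineqs_open_polyhedral_cone C :
  generic C -> open_polyhedral_cone (crit_ineqs C).
Proof.
move=> gC.
(* A path repeats no edge, so that its weight only depends on its edge set; this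
   indexes the inequalities by a finite type. *)
pose normal (x : V * V * {set edge E}) : {ffun edge E -> R} :=
  [ffun e => (e \in crit_path C x.1.1 x.1.2)%:R - (e \in x.2)%:R].
pose edges p := finset (fun e => e \in p).
pose A := [set a | exists i j p, [/\ i != j, dipath (E := E) i j !=set0,
  (dipath i j `\ crit_path C i j) p & a = normal (i, j, edges p)]].
have normalE (C' : weights R E) i j p : i != j -> dipath (E := E) i j !=set0 ->
    dipath i j p -> \sum_e normal (i, j, edges p) e * C' e =
    pweight C' (crit_path C i j) - pweight C' p.
  move=> ij hij ijp; have cC := crit_pathP gC ij hij.
  rewrite (pweight_uniq _ (dipath_uniq ijp)) (pweight_uniq _ (dipath_uniq cC.1)).
  by rewrite -sumrB; apply: eq_bigr => e _; rewrite ffunE finset.inE mulrBl.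
have AE : crit_ineqs C = \bigcap_(a in A) open_halfspace a.
  apply/seteqP; split=> C' /=.
    move=> hC' _ [i [j [p [ij hij ijp ->]]]].
    by rewrite /open_halfspace /= normalE ?subr_gt0; [exact: hC'|..|case: ijp].
  move=> hC' i j ij hij p ijp.
  rewrite -subr_gt0 -normalE //; last by case: ijp.
  by apply: hC'; exists i, j, p.
exists A; split=> //.
- apply: (@sub_finite_set _ _ (normal @` setT)).
    by move=> _ [i [j [p [_ _ _ ->]]]]; exists (i, j, edges p).
  exact/finite_image/finite_finset.
(* A zero normal would force [0 < 0] at the point [C] of the cone. *)
- move=> A0; have : crit_ineqs C C by exact: generic_crit_ineqs.
  rewrite AE => /(_ _ A0); rewrite /open_halfspace /= big1 ?ltxx // => e _.
  by rewrite ffunE mul0r.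
Qed.

End Weights.
End DAG.

Theorem theorem2p9 (R : realType) (V : finType) (E : rel V)
    (hE : acyclic E) (C : weights R E) (hC : generic C) :
  [/\ open_polyhedral_cone (maxoid_cone C),
      full_dimensional (maxoid_cone C) &
      maxoid_cone C =
        [set C' : weights R E |
          forall i j : V, i != j -> dipath (E := E) i j !=set0 ->
          forall p : seq (edge E),
            (dipath i j `\ crit_path C i j) p ->
            pweight C' (crit_path C i j) > pweight C' p]].
Proof.
have coneE := maxoid_cone_crit_ineqs hE hC.
have coneO : open_polyhedral_cone (maxoid_cone C).
  by rewrite coneE; exact: crit_ineqs_open_polyhedral_cone.
split=> //; apply: open_polyhedral_cone_full_dimensional => //.
by exists C; rewrite coneE; exact: generic_crit_ineqs.
Qed.
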